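(* Let $E$ be a truncated Banach lattice such that for every $x\in E^{+}$ there exists $\mu\in(0,\infty)$ with $\mu x\in E_{*}$, where $E_{*}=\{x\in E:|x|^{*}=|x|\}$. Then the formula $$\|x\|_{\infty}=\inf\left\{\lambda\in(0,\infty):\tfrac{1}{\lambda}x\in E_{*}\right\},\qquad x\in E,$$ defines a lattice norm on $E$ under which $E$ is lattice isometric to $C_{0}(X)$ for some locally compact Hausdorff space $X$.
   Context: All Riesz spaces are real. A truncated Riesz space is a nonzero Riesz space $E$ together with a truncation, i.e. a nonzero map $x\mapsto x^{*}$ from the positive cone $E^{+}$ into itself such that $x\wedge y^{*}\leq x^{*}\leq x$ for all $x,y\in E^{+}$. A lattice norm on a Riesz space is a norm such that $|u|\leq|v|$ implies $\|u\|\leq\|v\|$. A truncated normed Riesz space is a truncated Riesz space $E$ with a lattice norm $\|\cdot\|$ for which the truncation is norm-bounded; as a standing normalization, $\sup\{\|x^{*}\|:x\in E^{+}\}=1$. A truncated Banach lattice is a truncated normed Riesz space whose norm is complete. $C_0(X)$ is the Banach lattice (pointwise order, supremum norm) of all real-valued continuous functions on $X$ vanishing at infinity. Lattice isometric means isomorphic via a linear bijective lattice homomorphism that is an isometry. *)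

(* Defs.v *)
From HB Require Import structures.
From mathcomp Require Import all_boot all_order all_algebra.
From mathcomp Require Import all_classical all_reals all_analysis.

Set Implicit Arguments.
Unset Strict Implicit.
Unset Printing Implicit Defensive.

Import Order.TTheory GRing.Theory Num.Theory.
Import numFieldNormedType.Exports.

Local Open Scope classical_set_scope.
Local Open Scope ring_scope.

(* A Riesz space is an ordered vector space in which any two elements have a
   supremum and an infimum. The two lattice operations are fields, not the
   ones of [latticeType]: Hierarchy Builder rejects a join of [latticeType]
   with [lmodType], for want of a common structure below [realDomainType]. *)
HB.mixin Record POrderedLmodule_isRiesz (R : realType) V
    of GRing.Lmodule R V & Num.POrderedZmodule V := {
  rieszD2l : forall z x y : V, x <= y -> z + x <= z + y ;
  rieszZ_ge0 : forall (a : R) (x : V), 0 <= a -> 0 <= x -> 0 <= a *: x ;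
  rjoin : V -> V -> V ;
  rmeet : V -> V -> V ;
  rjoin_le : forall x y z : V, (rjoin x y <= z) = (x <= z) && (y <= z) ;
  le_rmeet : forall x y z : V, (z <= rmeet x y) = (z <= x) && (z <= y)
}.

#[short(type="rieszType")]
HB.structure Definition Riesz (R : realType) :=
  { V of GRing.Lmodule R V & Num.POrderedZmodule V
       & POrderedLmodule_isRiesz R V }.

(* The lattice absolute value of [E]; [`|_|] is the one of [R]. *)
Definition rabs (R : realType) (E : rieszType R) (x : E) : E :=
  rjoin x (- x).

Record lattice_norm (R : realType) (E : rieszType R) (N : E -> R) : Prop := {
  lattice_normD : forall x y, N (x + y) <= N x + N y ;
  lattice_normZ : forall a x, N (a *: x) = `|a| * N x ;
  lattice_norm_eq0 : forall x, N x = 0 -> x = 0 ;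
  lattice_norm_mono : forall u v, rabs u <= rabs v -> N u <= N v
}.

(* A truncation lives on the positive cone of [E]: [tr] is a total function
   whose values outside the cone are irrelevant. *)
Record truncation (R : realType) (E : rieszType R) (tr : E -> E) : Prop := {
  truncation_space_neq0 : exists x : E, x != 0 ;
  truncation_ge0 : forall x, 0 <= x -> 0 <= tr x ;
  truncation_neq0 : exists2 x, 0 <= x & tr x != 0 ;
  truncation_meet : forall x y, 0 <= x -> 0 <= y ->
    rmeet x (tr y) <= tr x ;
  truncation_le : forall x, 0 <= x -> tr x <= x
}.

Definition norm_complete (R : realType) (E : rieszType R) (N : E -> R) : Prop :=
  forall u : nat -> E,
    (forall e, 0 < e -> exists n, forall p q, (n <= p)%N -> (n <= q)%N ->
       N (u p - u q) < e) ->
    exists l, forall e, 0 < e -> exists n, forall p, (n <= p)%N ->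
       N (u p - l) < e.

Definition truncation_norms (R : realType) (E : rieszType R)
    (N : E -> R) (tr : E -> E) : set R :=
  [set N (tr x) | x in [set x : E | 0 <= x]].

Record truncated_normed_riesz (R : realType) (E : rieszType R)
    (N : E -> R) (tr : E -> E) : Prop := {
  tnr_truncation : truncation tr ;
  tnr_lattice_norm : lattice_norm N ;
  tnr_bounded : has_ubound (truncation_norms N tr) ;
  tnr_normalized : sup (truncation_norms N tr) = 1
}.

Definition truncated_banach_lattice (R : realType) (E : rieszType R)
    (N : E -> R) (tr : E -> E) : Prop :=
  truncated_normed_riesz N tr /\ norm_complete N.

Definition trunc_fixed (R : realType) (E : rieszType R) (tr : E -> E) : set E :=
  [set x | tr (rabs x) = rabs x].

(* [inf] is the infimum in [R], with value 0 on an empty set. *)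
Definition trunc_norm (R : realType) (E : rieszType R) (tr : E -> E) (x : E) : R :=
  inf [set l : R | 0 < l /\ trunc_fixed tr (l^-1 *: x)].

Definition C0 (R : realType) (X : topologicalType) : set (X -> R) :=
  [set f | continuous f /\
           forall e : R, 0 < e -> compact [set t | e <= `|f t|]].

Definition sup_norm (R : realType) (X : Type) (f : X -> R) : R :=
  sup (range (fun t => `|f t|)).

Record lattice_isometry_C0 (R : realType) (E : rieszType R) (N : E -> R)
    (X : topologicalType) (phi : E -> (X -> R)) : Prop := {
  lattice_isometry_linear : linear (phi : E -> (X -> R^o)) ;
  lattice_isometry_join : forall x y,
    phi (rjoin x y) = phi x \max phi y ;
  lattice_isometry_meet : forall x y,
    phi (rmeet x y) = phi x \min phi y ;
  lattice_isometry_bij : set_bij setT (@C0 R X) phi ;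
  lattice_isometry_norm : forall x, sup_norm (phi x) = N x
}.

(* Main.v *)
Require Import Defs.
From mathcomp Require Import all_boot all_order all_algebra.
From mathcomp Require Import all_classical all_reals all_analysis.
From mathcomp Require Import ring.

Import Order.TTheory GRing.Theory Num.Theory.
Import numFieldNormedType.Exports.

Set Implicit Arguments.
Unset Strict Implicit.
Unset Printing Implicit Defensive.

Local Open Scope classical_set_scope.
Local Open Scope ring_scope.

(** Call [x] fixed when [tr |x| = |x|]. The axiom of a truncation makes the set
    of fixed elements solid and stable under finite joins of positive elements,
    hence convex; it is absorbing by hypothesis and bounded by 1 for the norm
    [N]. Its gauge is therefore a lattice norm that dominates [N] and satisfies
    the M-property, that is, the norm of [x \/ y] is the maximum of the norms of
    [x] and [y] for positive [x] and [y]. As the order is closed for [N], so is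
    the set of fixed elements ([trunc_fixed_closed]): the gauge of [x] is at
    most [l] if and only if [x / l] is fixed.

    The points of the locally compact space are the truncation characters, the
    nonzero real lattice homomorphisms that send [tr x] to the minimum of the
    value at [x] and 1, with the topology of pointwise convergence.

    Characters separate the points of [E] ([exists_character]), by the following
    argument. Given [w > 0], Zorn's lemma yields a minimal M-seminorm among
    those below the gauge that agree with it at [w]. Minimality forces it to
    vanish on one of any two disjoint elements, because otherwise passing to the
    quotients by the ideals that they generate would decrease it. So [E] modulo
    the null space of this seminorm is totally ordered and Archimedean, that is,
    a line, and the coordinate along [w] is a lattice homomorphism. Rescaled so
    that its supremum on the fixed elements is 1, it is a character. Applied to
    [|x| - tr |x|], this shows that [x] is fixed if and only if all characters
    are at most 1 in absolute value at [x], so that evaluation is isometric from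
    the gauge to the supremum norm.

    Ultrafilter limits of characters on which a given [x] stays away from zero
    are characters, which gives local compactness and shows that evaluations
    vanish at infinity. Distinct characters are linearly independent, since
    their common normalization excludes proportional ones; the lattice form of
    the Stone-Weierstrass theorem then makes the evaluations dense. Finally,
    the completeness of [N] and the closedness of the fixed elements make the
    gauge complete, so evaluation is surjective. *)

(** * Calculus in Riesz spaces *)
Section RieszSpaces.
Context {R : realType} {E : rieszType R}.
Implicit Types (a b c r s : R) (u v w x y z : E).

Lemma riesz_leD2l z x y : (z + x <= z + y) = (x <= y).
Proof.
apply/idP/idP => [/(rieszD2l (- z))|]; last exact: rieszD2l.
by rewrite !addKr.
Qed.

Lemma riesz_leD2r z x y : (x + z <= y + z) = (x <= y).
Proof. by rewrite ![_ + z]addrC riesz_leD2l. Qed.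

Lemma riesz_leD x y z w : x <= y -> z <= w -> x + z <= y + w.
Proof.
by move=> xy zw; apply: (@le_trans _ _ (y + z));
  rewrite ?riesz_leD2r ?riesz_leD2l.
Qed.

Lemma riesz_leBlDr x y z : (x - y <= z) = (x <= z + y).
Proof. by rewrite -[LHS](riesz_leD2r y) subrK. Qed.

Lemma riesz_leBrDr x y z : (x <= y - z) = (x + z <= y).
Proof. by rewrite -[LHS](riesz_leD2r z) subrK. Qed.

Lemma riesz_subr_ge0 x y : (0 <= y - x) = (x <= y).
Proof. by rewrite riesz_leBrDr add0r. Qed.

Lemma riesz_leN2 x y : (- x <= - y) = (y <= x).
Proof. by rewrite -[LHS]riesz_subr_ge0 opprK addrC riesz_subr_ge0. Qed.

Lemma riesz_leNl x y : (- x <= y) = (- y <= x).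
Proof. by rewrite -{1}[y]opprK riesz_leN2. Qed.

Lemma riesz_leNr x y : (x <= - y) = (y <= - x).
Proof. by rewrite -{1}[x]opprK riesz_leN2. Qed.

Lemma riesz_addr_ge0 x y : 0 <= x -> 0 <= y -> 0 <= x + y.
Proof. by move=> x0 y0; rewrite -(addr0 0); exact: riesz_leD. Qed.

Lemma riesz_leZ a x y : 0 <= a -> x <= y -> a *: x <= a *: y.
Proof.
by move=> a0 xy; rewrite -riesz_subr_ge0 -scalerBr rieszZ_ge0 ?riesz_subr_ge0.
Qed.

Lemma riesz_leZr a b x : 0 <= x -> a <= b -> a *: x <= b *: x.
Proof.
by move=> x0 ab; rewrite -riesz_subr_ge0 -scalerBl rieszZ_ge0 ?subr_ge0.
Qed.

Lemma riesz_lepZ a x y : 0 < a -> (a *: x <= a *: y) = (x <= y).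
Proof.
move=> a0; apply/idP/idP; last by apply: riesz_leZ; exact: ltW.
have ai : 0 <= a^-1 by rewrite invr_ge0 ltW.
by move/(riesz_leZ ai); rewrite !scalerA mulVf ?gt_eqF// !scale1r.
Qed.

Lemma le_rjoinl x y : x <= rjoin x y.
Proof. by have := lexx (rjoin x y); rewrite rjoin_le => /andP[]. Qed.

Lemma le_rjoinr x y : y <= rjoin x y.
Proof. by have := lexx (rjoin x y); rewrite rjoin_le => /andP[]. Qed.

Lemma rmeet_lel x y : rmeet x y <= x.
Proof. by have := lexx (rmeet x y); rewrite le_rmeet => /andP[]. Qed.

Lemma rmeet_ler x y : rmeet x y <= y.
Proof. by have := lexx (rmeet x y); rewrite le_rmeet => /andP[]. Qed.

Lemma rjoinC x y : rjoin x y = rjoin y x.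
Proof. by apply: le_anti; rewrite !rjoin_le !le_rjoinl !le_rjoinr. Qed.

Lemma rjoin_l x y : y <= x -> rjoin x y = x.
Proof. by move=> yx; apply: le_anti; rewrite rjoin_le lexx yx le_rjoinl. Qed.

Lemma le_rjoin x y z w : x <= z -> y <= w -> rjoin x y <= rjoin z w.
Proof.
by move=> xz yw; rewrite rjoin_le (le_trans xz (le_rjoinl _ _))
  (le_trans yw (le_rjoinr _ _)).
Qed.

Lemma rjoinDl z x y : z + rjoin x y = rjoin (z + x) (z + y).
Proof.
apply: le_anti; rewrite rjoin_le !riesz_leD2l le_rjoinl le_rjoinr andbT.
rewrite addrC -riesz_leBrDr rjoin_le !riesz_leBrDr ![_ + z]addrC.
by rewrite le_rjoinl le_rjoinr.
Qed.

Lemma rjoinZ a x y : 0 <= a -> a *: rjoin x y = rjoin (a *: x) (a *: y).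
Proof.
rewrite le_eqVlt => /predU1P[<-|a0]; first by rewrite !scale0r rjoin_l.
have le_joinZ b u v : 0 < b -> rjoin (b *: u) (b *: v) <= b *: rjoin u v.
  by move=> b0; rewrite rjoin_le !riesz_lepZ// le_rjoinl le_rjoinr.
apply: le_anti; rewrite le_joinZ// andbT.
have ai : 0 < a^-1 by rewrite invr_gt0.
rewrite -(riesz_lepZ _ _ ai) scalerA mulVf ?gt_eqF// scale1r.
by have := le_joinZ _ (a *: x) (a *: y) ai;
  rewrite !scalerA mulVf ?gt_eqF// !scale1r.
Qed.

Lemma rmeetE x y : rmeet x y = - rjoin (- x) (- y).
Proof.
apply: le_anti; apply/andP; split.
  by rewrite riesz_leNr rjoin_le !riesz_leN2 rmeet_lel rmeet_ler.
by rewrite le_rmeet riesz_leNl le_rjoinl riesz_leNl le_rjoinr.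
Qed.

(** The reflection [z |-> x + y - z] exchanges [x] and [y] and reverses the
    order, so it exchanges their supremum and their infimum. *)
Lemma rmeet_rjoinE x y : rmeet x y = x + y - rjoin x y.
Proof.
have := rjoinDl (x + y) (- x) (- y).
rewrite [x + y - x]addrC addKr addrK => h.
by rewrite rmeetE (rjoinC x) -h opprD addNKr.
Qed.

Lemma rmeetZ a x y : 0 <= a -> a *: rmeet x y = rmeet (a *: x) (a *: y).
Proof. by move=> a0; rewrite !rmeet_rjoinE scalerBr scalerDr rjoinZ. Qed.

Definition rpos x := rjoin x 0.

Lemma rpos_ge0 x : 0 <= rpos x. Proof. exact: le_rjoinr. Qed.
Lemma le_rpos x : x <= rpos x. Proof. exact: le_rjoinl. Qed.
Lemma rpos_id x : 0 <= x -> rpos x = x. Proof. exact: rjoin_l. Qed.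
Lemma rpos_mono x y : x <= y -> rpos x <= rpos y.
Proof. by move=> ?; exact: le_rjoin. Qed.
Lemma rposE x : rpos x = x + rpos (- x).
Proof. by rewrite rjoinDl subrr addr0 rjoinC. Qed.

(** Translating [x \/ 0] by the negative part gives the supremum of the two
    parts; it therefore equals their sum, and their infimum is what is left. *)
Lemma rmeet_pos_neg x : rmeet (rpos x) (rpos (- x)) = 0.
Proof.
have h : rpos (- x) + rpos x = rjoin (rpos x) (rpos (- x)).
  by rewrite rjoinDl addr0 [_ + x]addrC -rposE.
by rewrite rmeet_rjoinE -h [X in X - _]addrC subrr.
Qed.

Lemma rabsN x : rabs (- x) = rabs x.
Proof. by rewrite /rabs opprK rjoinC. Qed.

(** Adding [x <= |x|] and [- x <= |x|] gives [0 <= 2 |x|]. *)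
Lemma rabs_ge0 x : 0 <= rabs x.
Proof.
have h : 0 <= rabs x + rabs x.
  by rewrite -(subrr x) riesz_leD ?le_rjoinl ?le_rjoinr.
have -> : rabs x = 2^-1 *: (rabs x + rabs x).
  by rewrite -mulr2n -(scaler_nat 2 (rabs x)) scalerA mulVf ?scale1r ?pnatr_eq0.
by rewrite rieszZ_ge0 ?invr_ge0 ?ler0n.
Qed.

Lemma rabs_id x : 0 <= x -> rabs x = x.
Proof.
by move=> x0; rewrite /rabs rjoin_l// (le_trans _ x0)// -oppr0 riesz_leN2.
Qed.

Lemma le_rabs x : x <= rabs x. Proof. exact: le_rjoinl. Qed.
Lemma leN_rabs x : - x <= rabs x. Proof. exact: le_rjoinr. Qed.

Lemma rabs_le x y : (rabs x <= y) = (x <= y) && (- x <= y).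
Proof. exact: rjoin_le. Qed.

Lemma rabsD x y : rabs (x + y) <= rabs x + rabs y.
Proof. by rewrite rabs_le opprD !riesz_leD ?le_rabs ?leN_rabs. Qed.

Lemma rabsZ a x : rabs (a *: x) = `|a| *: rabs x.
Proof.
wlog a0 : a / 0 <= a => [h|].
  have [|/ltW a0] := leP 0 a; first exact: h.
  by rewrite -rabsN -scaleNr h ?normrN// oppr_ge0.
by rewrite ger0_norm// /rabs -scalerN rjoinZ.
Qed.

Lemma rabs_pos_neg x : rabs x = rpos x + rpos (- x).
Proof.
have h : x + rabs x = 2 *: rpos x.
  by rewrite rjoinDl subrr rjoinZ// scaler0 scaler_nat mulr2n.
by apply: (addrI x); rewrite h addrCA -rposE scaler_nat.
Qed.

Lemma rabs_eq0 x : rabs x = 0 -> x = 0.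
Proof.
move=> h; apply: le_anti; rewrite -{1}h le_rabs/= -riesz_leN2 oppr0 -h.
exact: leN_rabs.
Qed.

Lemma rposD x y : rpos (x + y) <= rpos x + rpos y.
Proof.
rewrite rjoin_le (riesz_leD (le_rpos x) (le_rpos y)).
by rewrite (riesz_addr_ge0 (rpos_ge0 x) (rpos_ge0 y)).
Qed.

Lemma rposZ a x : 0 <= a -> rpos (a *: x) = a *: rpos x.
Proof. by move=> a0; rewrite /rpos rjoinZ// scaler0. Qed.

Lemma rpos_join x y : rpos (rjoin x y) <= rjoin (rpos x) (rpos y).
Proof.
rewrite rjoin_le le_rjoin ?le_rpos//=.
exact: le_trans (rpos_ge0 x) (le_rjoinl _ _).
Qed.

Lemma rabs_join x y z w :
  rabs (rjoin x y - rjoin z w) <= rabs (x - z) + rabs (y - w).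
Proof.
set d := _ + rabs (y - w).
have dl v : v <= rabs (x - z) -> v <= d.
  by move=> h; rewrite -[v]addr0 riesz_leD ?rabs_ge0.
have dr v : v <= rabs (y - w) -> v <= d.
  by move=> h; rewrite -[v]add0r riesz_leD ?rabs_ge0.
have key x' y' z' w' : x' - z' <= d -> y' - w' <= d ->
    rjoin x' y' - rjoin z' w' <= d.
  rewrite !riesz_leBlDr => h1 h2; rewrite rjoin_le; apply/andP; split.
    by apply: le_trans h1 _; rewrite riesz_leD2l le_rjoinl.
  by apply: le_trans h2 _; rewrite riesz_leD2l le_rjoinr.
rewrite rabs_le opprB; apply/andP; split; apply: key.
- exact/dl/le_rabs.
- exact/dr/le_rabs.
- by apply: dl; rewrite -opprB leN_rabs.
- by apply: dr; rewrite -opprB leN_rabs.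
Qed.

End RieszSpaces.

(** * Lattice norms *)
Section LatticeNorms.
Context {R : realType} {E : rieszType R} (N : E -> R).
Hypothesis hN : lattice_norm N.
Implicit Types (x y : E).

Lemma lattice_norm0 : N 0 = 0.
Proof. by rewrite -(scale0r 0) (lattice_normZ hN) normr0 mul0r. Qed.

Lemma lattice_norm_ge0 x : 0 <= N x.
Proof.
rewrite -lattice_norm0; apply: (lattice_norm_mono hN).
by rewrite (rabs_id (lexx 0)) rabs_ge0.
Qed.

Lemma lattice_norm_abs x : N (rabs x) = N x.
Proof.
have h := rabs_id (rabs_ge0 x).
by apply: le_anti; rewrite !(lattice_norm_mono hN) ?h.
Qed.

Lemma lattice_norm_le x y : 0 <= x -> x <= rabs y -> N x <= N y.
Proof. by move=> x0 xy; apply: (lattice_norm_mono hN); rewrite rabs_id. Qed.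

End LatticeNorms.

(** * Elements fixed by a truncation *)
Section Truncations.
Context {R : realType} {E : rieszType R} (tr : E -> E).
Hypothesis htr : truncation tr.
Implicit Types (a r s : R) (u v x y : E).

Lemma trunc_idem x : 0 <= x -> tr (tr x) = tr x.
Proof.
move=> x0; have tx0 := truncation_ge0 htr x0.
apply: le_anti; rewrite (truncation_le htr tx0)/=.
by apply: le_trans (truncation_meet htr tx0 x0); rewrite le_rmeet lexx.
Qed.

(** A fixed [y] above [x] gives [x = x /\ tr y <= tr x]. *)
Lemma trunc_id_le x y : 0 <= x -> x <= y -> tr y = y -> tr x = x.
Proof.
move=> x0 xy ty; apply: le_anti; rewrite (truncation_le htr x0)/=.
have y0 := le_trans x0 xy.
by apply: le_trans (truncation_meet htr x0 y0); rewrite ty le_rmeet lexx.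
Qed.

(** With [z = x \/ y], the axiom gives [x = z /\ tr x <= tr z], and likewise
    for [y]. *)
Lemma trunc_id_join x y : 0 <= x -> 0 <= y -> tr x = x -> tr y = y ->
  tr (rjoin x y) = rjoin x y.
Proof.
move=> x0 y0 tx ty; have xy0 := le_trans x0 (le_rjoinl x y).
apply: le_anti; rewrite (truncation_le htr xy0)/= rjoin_le.
apply/andP; split.
- apply: le_trans (truncation_meet htr xy0 x0).
  by rewrite tx le_rmeet lexx le_rjoinl.
- apply: le_trans (truncation_meet htr xy0 y0).
  by rewrite ty le_rmeet lexx le_rjoinr.
Qed.

Lemma trunc_fixed_solid u v : rabs u <= rabs v ->
  trunc_fixed tr v -> trunc_fixed tr u.
Proof. by move=> uv; exact: trunc_id_le (rabs_ge0 u) uv. Qed.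

Lemma trunc_fixed_join x y : trunc_fixed tr x -> trunc_fixed tr y ->
  trunc_fixed tr (rjoin (rabs x) (rabs y)).
Proof.
move=> fx fy; rewrite /trunc_fixed/= rabs_id.
  by apply: trunc_id_join; rewrite ?rabs_ge0.
by apply: le_trans (rabs_ge0 x) (le_rjoinl _ _).
Qed.

(** A convex combination is dominated by the supremum [|x| \/ |y|], so
    convexity comes for free from solidity and stability under joins. *)
Lemma trunc_fixed_convex s r x y : 0 <= s -> 0 <= r -> s + r = 1 ->
  trunc_fixed tr x -> trunc_fixed tr y -> trunc_fixed tr (s *: x + r *: y).
Proof.
move=> s0 r0 sr fx fy; apply: trunc_fixed_solid (trunc_fixed_join fx fy).
set j := rjoin _ _; rewrite (le_trans _ (le_rabs j))// -[leRHS]scale1r -sr.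
rewrite scalerDl (le_trans (rabsD _ _))// !rabsZ !ger0_norm//.
by apply: riesz_leD; apply: riesz_leZ => //; rewrite /j ?le_rjoinl ?le_rjoinr.
Qed.

End Truncations.

(** * The gauge of the fixed elements *)
Section Gauge.
Context {R : realType} {E : rieszType R} (N : E -> R) (tr : E -> E).
Hypothesis hE : truncated_normed_riesz N tr.
Hypothesis hfix : forall x : E, 0 <= x ->
  exists2 mu : R, 0 < mu & trunc_fixed tr (mu *: x).
Implicit Types (a e l m r s : R) (u v x y : E).

Let htr := tnr_truncation hE.
Let hN := tnr_lattice_norm hE.

Lemma trunc_fixed_norm_le1 x : trunc_fixed tr x -> N x <= 1.
Proof.
move=> fx; rewrite -(tnr_normalized hE) -(lattice_norm_abs hN) -fx.
by apply: (ub_le_sup (tnr_bounded hE)); exists (rabs x) => //=; exact: rabs_ge0.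
Qed.

(** If [y] is fixed then [|x| - tr |x| <= |x| - |x| /\ |y| <= |x - y|], so a
    norm limit of fixed elements is fixed. *)
Lemma trunc_fixed_closed x :
  (forall e, 0 < e -> exists2 y, trunc_fixed tr y & N (x - y) < e) ->
  trunc_fixed tr x.
Proof.
move=> happ; apply/eqP; rewrite eq_sym -subr_eq0; apply/eqP.
have d0 : 0 <= rabs x - tr (rabs x).
  by rewrite riesz_subr_ge0 (truncation_le htr) ?rabs_ge0.
apply: (lattice_norm_eq0 hN); apply: le_anti.
rewrite (lattice_norm_ge0 hN) andbT; apply/ler_addgt0Pr => e.
rewrite add0r => /happ[y fy /ltW].
apply: le_trans; apply: (lattice_norm_le hN) => //.
have := truncation_meet htr (rabs_ge0 x) (rabs_ge0 y).
rewrite fy rmeet_rjoinE riesz_leBlDr => h.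
rewrite riesz_leBlDr -(riesz_leD2r (rabs y)); apply: le_trans h _.
rewrite addrAC [leRHS]addrC riesz_leD2l rjoin_le.
rewrite -[X in _ && (X <= _)]add0r riesz_leD2r rabs_ge0 andbT.
by rewrite -{1}(subrK y x) rabsD.
Qed.

Lemma trunc_fixedV x : exists2 l, 0 < l & trunc_fixed tr (l^-1 *: x).
Proof.
have [mu mu0 fx] := hfix (rabs_ge0 x).
exists mu^-1; rewrite ?invr_gt0// invrK.
apply: (trunc_fixed_solid htr) fx.
by rewrite !rabsZ (rabs_id (rabs_ge0 x)).
Qed.

Lemma trunc_fixedZ_le l m x : 0 < l -> l <= m ->
  trunc_fixed tr (l^-1 *: x) -> trunc_fixed tr (m^-1 *: x).
Proof.
move=> l0 lm; have m0 := lt_le_trans l0 lm.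
apply: (trunc_fixed_solid htr); rewrite !rabsZ riesz_leZr ?rabs_ge0//.
by rewrite !gtr0_norm ?invr_gt0// lef_pV2.
Qed.

Lemma trunc_norm_ge0 x : 0 <= trunc_norm tr x.
Proof.
have [l l0 fl] := trunc_fixedV x.
by apply: lb_le_inf => [|_ /= [/ltW]//]; exists l.
Qed.

(** The infimum that defines the gauge is attained because the fixed elements
    are closed for the norm of [E]. *)
Lemma trunc_norm_leP l x : 0 < l ->
  trunc_norm tr x <= l <-> trunc_fixed tr (l^-1 *: x).
Proof.
move=> l0; split=> [xl|fx]; last by apply: ge_inf => //; exists 0 => ? [/ltW].
apply: trunc_fixed_closed => e e0.
set y := l^-1 *: x; pose d := e / (N y + 1).
have Ny1 : 0 < N y + 1 by rewrite ltr_wpDl ?(lattice_norm_ge0 hN).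
have d0 : 0 < d by rewrite divr_gt0.
have d1 : 0 < 1 + d by rewrite addr_gt0.
have ld : l < l * (1 + d) by rewrite ltr_pMr// ltrDl.
have [m [m0 fm] ml] : exists2 m, 0 < m /\ trunc_fixed tr (m^-1 *: x) &
    m < l * (1 + d).
  apply: (@inf_lt _ [set m | _ /\ _]); last exact: (le_lt_trans xl ld).
  have [k k0 fk] := trunc_fixedV x.
  by exists k.
(* [d] is chosen so that [y] and [y / (1 + d)] are at distance below [e]. *)
exists ((l * (1 + d))^-1 *: x); first exact: trunc_fixedZ_le m0 (ltW ml) fm.
rewrite invfM mulrC -scalerA -/y -{1}[y]scale1r -scalerBl (lattice_normZ hN).
have -> : 1 - (1 + d)^-1 = d / (1 + d) by field; rewrite gt_eqF.
rewrite (ger0_norm (divr_ge0 (ltW d0) (ltW d1))).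
apply: (@le_lt_trans _ _ (d * N y)).
  rewrite ler_wpM2r ?(lattice_norm_ge0 hN)// ler_pdivrMr// ler_peMr ?(ltW d0)//.
  by rewrite lerDl ltW.
by rewrite /d mulrAC ltr_pdivrMr// ltr_pM2l// ltrDl.
Qed.

Lemma trunc_norm_le_abs x y : rabs x <= rabs y ->
  trunc_norm tr x <= trunc_norm tr y.
Proof.
move=> xy; apply/ler_addgt0Pr => e e0.
have l0 : 0 < trunc_norm tr y + e by rewrite ltr_wpDl ?trunc_norm_ge0.
apply/trunc_norm_leP => //.
have /trunc_norm_leP : trunc_norm tr y <= trunc_norm tr y + e.
  by rewrite lerDl ltW.
move=> /(_ l0); apply: (trunc_fixed_solid htr).
by rewrite !rabsZ riesz_leZ.
Qed.

Lemma trunc_normD x y :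
  trunc_norm tr (x + y) <= trunc_norm tr x + trunc_norm tr y.
Proof.
apply/ler_addgt0Pr => e e0; have e2 : 0 < e / 2 by rewrite divr_gt0.
set l := trunc_norm tr x + e / 2; set m := trunc_norm tr y + e / 2.
have l0 : 0 < l by rewrite ltr_wpDl ?trunc_norm_ge0.
have m0 : 0 < m by rewrite ltr_wpDl ?trunc_norm_ge0.
have lm0 : 0 < l + m by rewrite addr_gt0.
have -> : trunc_norm tr x + trunc_norm tr y + e = l + m by rewrite /l /m; field.
have /trunc_norm_leP -/(_ l0) fl : trunc_norm tr x <= l by rewrite lerDl ltW.
have /trunc_norm_leP -/(_ m0) fm : trunc_norm tr y <= m by rewrite lerDl ltW.
apply/trunc_norm_leP => //.
have -> : (l + m)^-1 *: (x + y) =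
    (l / (l + m)) *: (l^-1 *: x) + (m / (l + m)) *: (m^-1 *: y).
  by rewrite !scalerA (mulrAC l) (mulrAC m) !mulfV ?gt_eqF// mul1r scalerDr.
apply: (trunc_fixed_convex htr) => //; try by rewrite divr_ge0 ?ltW.
by rewrite -mulrDl mulfV ?gt_eqF.
Qed.

Lemma trunc_normZ_le a x : trunc_norm tr (a *: x) <= `|a| * trunc_norm tr x.
Proof.
have [->|a0] := eqVneq a 0.
  rewrite scale0r normr0 mul0r; apply/ler_addgt0Pr => e e0.
  rewrite add0r; apply/trunc_norm_leP => //; rewrite scaler0.
  have [l l0] := trunc_fixedV 0.
  by rewrite scaler0.
have na : 0 < `|a| by rewrite normr_gt0.
rewrite mulrC -ler_pdivrMr//; apply/ler_addgt0Pr => e e0.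
have l0 : 0 < trunc_norm tr x + e by rewrite ltr_wpDl ?trunc_norm_ge0.
rewrite ler_pdivrMr// mulrC; apply/trunc_norm_leP; first by rewrite mulr_gt0.
have /trunc_norm_leP : trunc_norm tr x <= trunc_norm tr x + e.
  by rewrite lerDl ltW.
move=> /(_ l0); apply: (trunc_fixed_solid htr).
rewrite !rabsZ scalerA invfM normrM normfV normr_id mulrAC mulVf ?gt_eqF//.
by rewrite mul1r.
Qed.

Lemma trunc_norm_lattice_norm : lattice_norm (trunc_norm tr).
Proof.
split.
- exact: trunc_normD.
- move=> a x; apply: le_anti; rewrite trunc_normZ_le/=.
  have [->|a0] := eqVneq a 0; first by rewrite normr0 mul0r trunc_norm_ge0.
  rewrite -{1}[x]scale1r -(mulVf a0) -scalerA -ler_pdivlMl ?normr_gt0//.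
  by rewrite -normfV trunc_normZ_le.
- move=> x x0; apply: (lattice_norm_eq0 hN); apply: le_anti.
  rewrite (lattice_norm_ge0 hN) andbT; apply/ler_addgt0Pr => e e0.
  rewrite add0r.
  have /trunc_norm_leP -/(_ e0)/trunc_fixed_norm_le1 : trunc_norm tr x <= e.
    by rewrite x0 ltW.
  by rewrite (lattice_normZ hN) gtr0_norm ?invr_gt0// ler_pdivrMl// mulr1.
- exact: trunc_norm_le_abs.
Qed.

(** The gauge is an M-norm, because the fixed elements are stable under
    joins. *)
Lemma trunc_norm_join x y : 0 <= x -> 0 <= y ->
  trunc_norm tr (rjoin x y) <= Num.max (trunc_norm tr x) (trunc_norm tr y).
Proof.
move=> x0 y0; apply/ler_addgt0Pr => e e0; set l := _ + e.
have l0 : 0 < l by apply: ltr_wpDl => //; rewrite le_max trunc_norm_ge0.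
have /trunc_norm_leP -/(_ l0) fx : trunc_norm tr x <= l.
  by rewrite -[leLHS]addr0; apply: lerD (ltW e0); rewrite le_max lexx.
have /trunc_norm_leP -/(_ l0) fy : trunc_norm tr y <= l.
  by rewrite -[leLHS]addr0; apply: lerD (ltW e0); rewrite le_max lexx orbT.
apply/trunc_norm_leP => //.
have li : 0 <= l^-1 by rewrite invr_ge0 ltW.
have := trunc_fixed_join htr fx fy.
by rewrite !rabs_id ?rieszZ_ge0// -rjoinZ.
Qed.

End Gauge.

(** * M-seminorms on the positive cone *)
Section ConeSeminorms.
Context {R : realType} {E : rieszType R}.
Implicit Types (a e r s : R) (u v w x y z : E) (q : E -> R).

(** A lattice seminorm is determined by its restriction to the positive cone,
    where all the axioms live. The inequality [msnZ_le] is the half of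
    homogeneity that survives directed infima literally; equality follows from
    it ([msnZ]). *)
Record cone_Mseminorm q : Prop := {
  msn_mono : forall x y, 0 <= x -> x <= y -> q x <= q y ;
  msnD : forall x y, 0 <= x -> 0 <= y -> q (x + y) <= q x + q y ;
  msnZ_le : forall a x, 0 <= a -> 0 <= x -> q (a *: x) <= a * q x ;
  msnU : forall x y, 0 <= x -> 0 <= y -> q (rjoin x y) <= Num.max (q x) (q y)
}.

Definition le_on_cone q q' := forall x, 0 <= x -> q x <= q' x.

Section Basics.
Variable q : E -> R.
Hypothesis hq : cone_Mseminorm q.

Lemma msn0 : q 0 = 0.
Proof.
apply: le_anti; apply/andP; split.
  by have := msnZ_le hq (lexx 0) (lexx 0); rewrite scale0r mul0r.
by have := msnD hq (lexx 0) (lexx 0); rewrite addr0 lerDl.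
Qed.

Lemma msn_ge0 x : 0 <= x -> 0 <= q x.
Proof. by move=> x0; rewrite -msn0 (msn_mono hq). Qed.

Lemma msnZ a x : 0 <= a -> 0 <= x -> q (a *: x) = a * q x.
Proof.
rewrite le_eqVlt => /predU1P[<-|a0] x0; first by rewrite scale0r mul0r msn0.
apply: le_anti; rewrite msnZ_le ?(ltW a0)//= -ler_pdivlMl//.
rewrite -{1}[x]scale1r -(mulVf (lt0r_neq0 a0)) -scalerA.
by apply: msnZ_le => //; rewrite ?invr_ge0 ?rieszZ_ge0// ltW.
Qed.

Lemma msn_eq0_le x y : 0 <= x -> x <= y -> q y = 0 -> q x = 0.
Proof.
move=> x0 xy qy; apply: le_anti.
by rewrite msn_ge0// andbT -qy (msn_mono hq).
Qed.

Lemma msn_le_add x y z : 0 <= x -> 0 <= y -> 0 <= z -> x <= y + z ->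
  q x <= q y + q z.
Proof.
by move=> x0 y0 z0 /(msn_mono hq x0) h; apply: le_trans h (msnD hq _ _).
Qed.

Definition msn_null v := q (rabs v) = 0.

Lemma msn_null_leD v w z : rabs v <= rabs w + rabs z ->
  msn_null w -> msn_null z -> msn_null v.
Proof.
rewrite /msn_null => h w0 z0; apply: (msn_eq0_le (rabs_ge0 v) h).
apply: le_anti; rewrite msn_ge0 ?riesz_addr_ge0 ?rabs_ge0// andbT.
by apply: le_trans (msnD hq (rabs_ge0 w) (rabs_ge0 z)) _; rewrite w0 z0 addr0.
Qed.

Lemma msn_nullD v w : msn_null v -> msn_null w -> msn_null (v + w).
Proof. exact: msn_null_leD (rabsD v w). Qed.

Lemma msn_nullZ a v : msn_null v -> msn_null (a *: v).
Proof. by rewrite /msn_null rabsZ msnZ ?rabs_ge0// => ->; rewrite mulr0. Qed.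

Lemma msn_null_rpos v : q (rpos v) = 0 -> q (rpos (- v)) = 0 -> msn_null v.
Proof.
move=> v0 w0; rewrite /msn_null rabs_pos_neg; apply: le_anti.
rewrite msn_ge0 ?riesz_addr_ge0 ?rpos_ge0// andbT.
by apply: le_trans (msnD hq (rpos_ge0 _) (rpos_ge0 _)) _; rewrite v0 w0 addr0.
Qed.

End Basics.

Lemma inf_range_le (I : Type) (p : I -> R) i : (forall j, 0 <= p j) ->
  inf (range p) <= p i.
Proof.
by move=> p0; apply: ge_inf; [exists 0 => _ [j _ <-] | exists i].
Qed.

(** The infimum of a family that satisfies the axioms up to a change of index.
    This covers both uses: a chain of M-seminorms, and the quotient seminorm,
    where no single member of the family is subadditive. *)
Lemma msn_inf (I : Type) (i0 : I) (p : I -> E -> R) :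
  (forall i x, 0 <= x -> 0 <= p i x) ->
  (forall i x y, 0 <= x -> x <= y -> p i x <= p i y) ->
  (forall i j x y, 0 <= x -> 0 <= y ->
     exists k, p k (x + y) <= p i x + p j y) ->
  (forall i a x, 0 <= a -> 0 <= x -> exists k, p k (a *: x) <= a * p i x) ->
  (forall i j x y, 0 <= x -> 0 <= y ->
     exists k, p k (rjoin x y) <= Num.max (p i x) (p j y)) ->
  cone_Mseminorm (fun x => inf (range (p^~ x))).
Proof.
move=> p0 pm pD pZ pU.
have lb x i : 0 <= x -> inf (range (p^~ x)) <= p i x.
  by move=> x0; apply: inf_range_le => j; exact: p0.
have ub x e : 0 < e -> exists i, p i x <= inf (range (p^~ x)) + e.
  move=> e0; have ne : range (p^~ x) !=set0 by exists (p i0 x), i0.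
  have : inf (range (p^~ x)) < inf (range (p^~ x)) + e by rewrite ltrDl.
  by move=> /(inf_lt ne)[_ [i _ <-] /ltW h]; exists i.
split.
- move=> x y x0 xy; apply/ler_addgt0Pr => e /(ub y)[i hi].
  exact: le_trans (lb x i x0) (le_trans (pm i _ _ x0 xy) hi).
- move=> x y x0 y0; apply/ler_addgt0Pr => e e0.
  have e2 : 0 < e / 2 by rewrite divr_gt0.
  have [i hi] := ub x _ e2; have [j hj] := ub y _ e2.
  have [k hk] := pD i j _ _ x0 y0.
  apply: le_trans (lb _ k (riesz_addr_ge0 x0 y0)) _; apply: le_trans hk _.
  by rewrite [e]splitr addrACA lerD.
- move=> a x a0 x0; apply/ler_addgt0Pr => e e0.
  have a1 : 0 < a + 1 by rewrite ltr_wpDl.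
  have [i hi] := ub x (e / (a + 1)) (divr_gt0 e0 a1).
  have [k hk] := pZ i _ _ a0 x0.
  apply: le_trans (lb _ k (rieszZ_ge0 _ _ a0 x0)) _; apply: le_trans hk _.
  apply: le_trans (ler_wpM2l a0 hi) _; rewrite mulrDr lerD2l.
  by rewrite mulrCA ger_pMr// ler_pdivrMr// mul1r lerDl.
- move=> x y x0 y0; apply/ler_addgt0Pr => e e0.
  have [i hi] := ub x _ e0; have [j hj] := ub y _ e0.
  have [k hk] := pU i j _ _ x0 y0.
  have xy0 := le_trans x0 (le_rjoinl x y).
  apply: le_trans (lb _ k xy0) _; apply: le_trans hk _.
  by rewrite addr_maxl; apply: le_max2.
Qed.

Definition minimal_above u q := forall q', cone_Mseminorm q' ->
  le_on_cone q' q -> q u <= q' u -> le_on_cone q q'.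

(** Infima of chains are again M-seminorms and do not decrease the bound at
    [u], so Zorn's lemma applies. *)
Lemma exists_minimal_msn g u : cone_Mseminorm g -> 0 <= u ->
  exists q, [/\ cone_Mseminorm q, le_on_cone q g, g u <= q u &
                minimal_above u q].
Proof.
move=> hg u0.
pose D q := [/\ cone_Mseminorm q, le_on_cone q g & g u <= q u].
pose T := {q : E -> R | D q}.
have hg' : D g by split=> // x.
pose ge_cone (s t : T) := `[< le_on_cone (sval t) (sval s) >].
have [|||[q [hq qg gq]] qmin] := @ZL_preorder T (exist D g hg') ge_cone.
- by move=> t; apply/asboolP => x _.
- move=> r s t /asboolP rs /asboolP st; apply/asboolP => x x0.
  exact: le_trans (st x x0) (rs x x0).
- move=> A Atot; have [[t0 At0]|A0] := pselect (exists t, A t); last first.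
    by exists (exist D g hg') => s As; case: A0; exists s.
  pose I := {t : T | A t}; pose p (i : I) := sval (sval i).
  have hp i : cone_Mseminorm (p i) by rewrite /p; case: (sval i) => ? [].
  have pg i : le_on_cone (p i) g by rewrite /p; case: (sval i) => ? [].
  have pu i : g u <= p i u by rewrite /p; case: (sval i) => ? [].
  have smaller (i j : I) : exists k,
      le_on_cone (p k) (p i) /\ le_on_cone (p k) (p j).
    have [/asboolP h|/asboolP h] := Atot _ _ (svalP i) (svalP j).
      by exists j; split=> // x _.
    by exists i; split=> // x _.
  have hinf : cone_Mseminorm (fun x => inf (range (p^~ x))).
    apply: (@msn_inf I (exist _ t0 At0) p).
    + by move=> i x; exact: msn_ge0.
    + by move=> i; exact: msn_mono.
    + move=> i j x y x0 y0; have [k [ki kj]] := smaller i j; exists k.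
      by apply: le_trans (msnD (hp k) x0 y0) _; rewrite lerD ?ki ?kj.
    + by move=> i a x a0 x0; exists i; exact: msnZ_le.
    + move=> i j x y x0 y0; have [k [ki kj]] := smaller i j; exists k.
      by apply: le_trans (msnU (hp k) x0 y0) _; rewrite le_max2 ?ki ?kj.
  have lb x i : 0 <= x -> inf (range (p^~ x)) <= p i x.
    by move=> x0; apply: inf_range_le => j; exact: (msn_ge0 (hp j)).
  have hT : D (fun x => inf (range (p^~ x))).
    split=> // [x x0|].
      exact: le_trans (lb x (exist _ t0 At0) x0) (pg _ x x0).
    apply: lb_le_inf => [|_ [i _ <-]//].
    by exists (p (exist _ t0 At0) u), (exist _ t0 At0).
  exists (exist D _ hT) => s As; apply/asboolP => x x0 /=.
  exact: (lb x (exist _ s As)).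
exists q; split=> // q' hq' q'q qu.
have hT : D q'.
  split=> // [x x0|]; last exact: le_trans gq qu.
  exact: le_trans (q'q x x0) (qg x x0).
by have /asboolP := qmin (exist D q' hT) (asboolT q'q).
Qed.

Section Quotient.
Variables (q : E -> R) (a : E).
Hypotheses (hq : cone_Mseminorm q) (a0 : 0 <= a).

(** The seminorm that [q] induces on the quotient by the ideal generated by
    [a]. The coefficient is taken as [`|r|] so that the index ranges over a
    type. *)
Definition msn_quotient x := inf (range (fun r => q (rpos (x - `|r| *: a)))).

Lemma msn_quotient_le x r : 0 <= r -> msn_quotient x <= q (rpos (x - r *: a)).
Proof.
move=> r0; rewrite -(ger0_norm r0).
apply: (@inf_range_le _ (fun r => q (rpos (x - `|r| *: a))) r) => s.
by rewrite (msn_ge0 hq) ?rpos_ge0.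
Qed.

Lemma msn_quotient_lt x e : msn_quotient x < e ->
  exists2 r, 0 <= r & q (rpos (x - r *: a)) < e.
Proof.
have ne : range (fun r => q (rpos (x - `|r| *: a))) !=set0.
  by exists (q (rpos (x - `|0 : R| *: a))), 0.
by move=> /(inf_lt ne)[_ [r _ <-] h]; exists `|r|.
Qed.

Lemma msn_quotient_le_on_cone : le_on_cone msn_quotient q.
Proof.
move=> x x0; apply: le_trans (msn_quotient_le x (lexx 0)) _.
by rewrite scale0r subr0 rpos_id.
Qed.

Lemma msn_quotient_self : msn_quotient a <= 0.
Proof.
apply: le_trans (msn_quotient_le a ler01) _.
by rewrite scale1r subrr rpos_id// (msn0 hq).
Qed.

Lemma msn_quotient_Mseminorm : cone_Mseminorm msn_quotient.
Proof.
have subZ x r s : 0 <= r -> r <= s -> x - s *: a <= x - r *: a.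
  by move=> r0 rs; rewrite riesz_leD2l riesz_leN2 riesz_leZr.
apply: (@msn_inf R 0).
- by move=> r x x0; rewrite (msn_ge0 hq) ?rpos_ge0.
- move=> r x y x0 xy; apply: (msn_mono hq); first exact: rpos_ge0.
  by apply: rpos_mono; rewrite riesz_leD2r.
- move=> r s x y x0 y0; exists (`|r| + `|s|).
  rewrite ger0_norm ?addr_ge0//; apply: (msn_le_add hq); rewrite ?rpos_ge0//.
  by rewrite scalerDl opprD addrACA rposD.
- move=> r b x b0 x0; exists (b * r).
  rewrite normrM (ger0_norm b0) -scalerA -scalerBr rposZ//.
  by rewrite (msnZ hq) ?rpos_ge0.
- move=> r s x y x0 y0; exists (Num.max `|r| `|s|).
  have m0 : 0 <= Num.max `|r| `|s| by rewrite le_max normr_ge0.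
  rewrite (ger0_norm m0).
  apply: le_trans _ (msnU hq (rpos_ge0 _) (rpos_ge0 _)).
  apply: (msn_mono hq (rpos_ge0 _)); apply: le_trans _ (rpos_join _ _).
  apply: rpos_mono; rewrite addrC rjoinDl.
  by apply: le_rjoin; rewrite addrC subZ ?normr_ge0// le_max lexx ?orbT.
Qed.

End Quotient.

(** If [q a] and [q b] are both nonzero, then passing to the quotient by [a]
    strictly decreases [q]; by minimality it must decrease the value at [u], so
    [(u - r a)^+] is smaller than [u] for [q], and likewise [(u - s b)^+]. As
    [a] and [b] are disjoint, [u] lies below the join of these two elements,
    which contradicts the M-property. *)
Lemma minimal_msn_disjoint q u : cone_Mseminorm q -> 0 <= u ->
  minimal_above u q ->
  forall a b : E, 0 <= a -> 0 <= b -> rmeet a b = 0 -> q a = 0 \/ q b = 0.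
Proof.
move=> hq u0 qmin a b a0 b0 ab.
have drop c : 0 <= c -> q c != 0 ->
    exists2 r, 0 <= r & q (rpos (u - r *: c)) < q u.
  move=> c0 qc; apply: msn_quotient_lt; rewrite ltNge; apply/negP => uc.
  have /(_ c c0) := qmin _ (msn_quotient_Mseminorm hq c0)
    (msn_quotient_le_on_cone c hq) uc.
  move=> /le_trans/(_ (msn_quotient_self c hq)) qc0.
  by move/eqP: qc; apply; apply: le_anti; rewrite qc0 (msn_ge0 hq).
have [->|/(drop a a0)[r r0 hr]] := eqVneq (q a) 0; first by left.
have [->|/(drop b b0)[s s0 hs]] := eqVneq (q b) 0; first by right.
exfalso.
have : u <= rjoin (rpos (u - r *: a)) (rpos (u - s *: b)).
  set j := rjoin _ _; rewrite -riesz_subr_ge0 -riesz_leN2 oppr0 opprB.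
  have -> : 0 = (r + s) *: rmeet a b by rewrite ab scaler0.
  rewrite rmeetZ ?addr_ge0// le_rmeet; apply/andP; split.
    apply: (@le_trans _ _ (r *: a)); last by rewrite riesz_leZr// lerDl.
    rewrite riesz_leBlDr addrC -riesz_leBlDr.
    exact: le_trans (le_rpos _) (le_rjoinl _ _).
  apply: (@le_trans _ _ (s *: b)); last by rewrite riesz_leZr// lerDr.
  rewrite riesz_leBlDr addrC -riesz_leBlDr.
  exact: le_trans (le_rpos _) (le_rjoinr _ _).
move/(msn_mono hq u0) => /le_trans/(_ (msnU hq (rpos_ge0 _) (rpos_ge0 _))).
by rewrite le_max !leNgt hr hs.
Qed.

(** * Lattice homomorphisms from minimal seminorms *)
Section Homomorphism.
Variables (q : E -> R) (u : E).
Hypotheses (hq : cone_Mseminorm q) (u0 : 0 <= u) (qu : 0 < q u).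
Hypothesis disj : forall x y, 0 <= x -> 0 <= y -> rmeet x y = 0 ->
  q x = 0 \/ q y = 0.

(** Modulo the null space of [q], every element is comparable to every
    multiple of [u], and the coordinate is the cut [r] between the multiples
    above [x] and those below. The element [x - r u] is then smaller than every
    multiple of [u], hence null. *)
Lemma msn_null_coordinate x : exists r, msn_null q (x - r *: u).
Proof.
have x0 := rabs_ge0 x.
have dich s : q (rpos (x - s *: u)) = 0 \/ q (rpos (s *: u - x)) = 0.
  by rewrite -[s *: u - x]opprB; apply: disj; rewrite ?rpos_ge0 ?rmeet_pos_neg.
pose S := [set s | q (rpos (x - s *: u)) = 0].
have S0 : S !=set0.
  (* A multiple of [u] too large in [q] to lie below [x]. *)
  pose s := (q (rabs x) + 1) / q u.
  have s0 : 0 <= s by rewrite divr_ge0 ?addr_ge0 ?(msn_ge0 hq) ?(ltW qu).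
  have [|h] := dich s; first by exists s.
  have : q (s *: u) <= q (rabs x) + q (rpos (s *: u - x)).
    apply: (msn_le_add hq); rewrite ?rpos_ge0 ?rieszZ_ge0//.
    by rewrite -{1}(subrK x (s *: u)) addrC riesz_leD ?le_rabs ?le_rpos.
  rewrite h addr0 (msnZ hq)// /s divfK ?gt_eqF// => h'.
  by move: h'; rewrite gerDl ler10.
have Slb : has_lbound S.
  exists (- (q (rabs x) / q u)) => s Ss; rewrite lerNl.
  have [s0|s0] := leP 0 (- s); last first.
    by rewrite (le_trans (ltW s0))// divr_ge0 ?(msn_ge0 hq).
  rewrite ler_pdivlMr// -(msnZ hq)//.
  rewrite -[leRHS]addr0 -Ss; apply: (msn_le_add hq);
    rewrite ?rpos_ge0 ?rieszZ_ge0//.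
  have -> : - s *: u = - x + (x - s *: u) by rewrite addKr scaleNr.
  by rewrite riesz_leD ?leN_rabs ?le_rpos.
exists (inf S); set r := inf S.
have small v : 0 <= v -> (forall e, 0 < e -> q v <= e * q u) -> q v = 0.
  move=> v0 h; apply: le_anti; rewrite (msn_ge0 hq)// andbT.
  apply/ler_addgt0Pr => e e0; rewrite add0r.
  by have := h (e / q u); rewrite divfK ?gt_eqF// divr_gt0// => ->.
apply: (msn_null_rpos hq); apply: small; rewrite ?rpos_ge0// => e e0.
  have : inf S < r + e by rewrite ltrDl.
  move=> /(inf_lt S0)[s Ss sr].
  have rs : 0 <= s - r by rewrite subr_ge0 ge_inf.
  apply: (@le_trans _ _ ((s - r) * q u)); last first.
    by rewrite ler_pM2r// lerBlDl ltW.
  rewrite -(msnZ hq)// -[leRHS]addr0 -Ss [leRHS]addrC.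
  apply: (msn_le_add hq); rewrite ?rpos_ge0 ?rieszZ_ge0//.
  rewrite -[X in _ <= _ + X]rpos_id ?rieszZ_ge0//.
  apply: le_trans _ (rposD _ _); apply: rpos_mono.
  by rewrite scalerBl addrA subrK.
have [h|h] := dich (r - e).
  have : r <= r - e by apply: ge_inf.
  by rewrite lerDl oppr_ge0 leNgt e0.
rewrite opprB -(msnZ hq) ?(ltW e0)// -[leRHS]addr0 -h [leRHS]addrC.
apply: (msn_le_add hq); rewrite ?rpos_ge0 ?rieszZ_ge0 ?(ltW e0)//.
rewrite -[X in _ <= _ + X]rpos_id ?rieszZ_ge0 ?(ltW e0)//.
apply: le_trans _ (rposD _ _); apply: rpos_mono.
by rewrite scalerBl addrAC subrK.
Qed.

Lemma msn_null_coordinate_uniq x r s :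
  msn_null q (x - r *: u) -> msn_null q (x - s *: u) -> r = s.
Proof.
move=> hr /(msn_nullZ hq (-1)) hs; have := msn_nullD hq hr hs.
rewrite scaleN1r opprB addrC addrA subrK -scalerBl /msn_null rabsZ (rabs_id u0).
rewrite (msnZ hq)// => /eqP.
by rewrite mulf_eq0 (gt_eqF qu) orbF normr_eq0 subr_eq0 => /eqP.
Qed.

(** [E] is the sum of the line through [u] and the null space of [q], which is
    an ideal: the coordinate along [u] is a lattice homomorphism. *)
Lemma exists_lattice_hom : exists phi : E -> R,
  [/\ forall a x y, phi (a *: x + y) = a * phi x + phi y,
      forall x y, phi (rjoin x y) = Num.max (phi x) (phi y),
      phi u = 1 &
      forall x, 0 <= x -> phi x * q u <= q x].
Proof.
have /choice[phi hphi] := msn_null_coordinate.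
have phiP x r : msn_null q (x - r *: u) -> phi x = r.
  exact: msn_null_coordinate_uniq.
exists phi; split.
- move=> a x y; apply: phiP; rewrite scalerDl opprD addrACA -scalerA -scalerBr.
  exact: (msn_nullD hq (msn_nullZ hq a (hphi x)) (hphi y)).
- move=> x y; apply: phiP.
  have -> : Num.max (phi x) (phi y) *: u = rjoin (phi x *: u) (phi y *: u).
    have [xy|/ltW yx] := leP (phi x) (phi y).
      by rewrite rjoinC rjoin_l// riesz_leZr.
    by rewrite rjoin_l// riesz_leZr.
  exact: (msn_null_leD hq (rabs_join x y _ _) (hphi x) (hphi y)).
- by apply: phiP; rewrite scale1r subrr /msn_null rabs_id// (msn0 hq).
- move=> x x0; have [|/ltW p0] := leP 0 (phi x); last first.
    exact: le_trans (mulr_le0_ge0 p0 (ltW qu)) (msn_ge0 hq x0).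
  move=> p0; rewrite -(msnZ hq)// -[leRHS]addr0 -(hphi x).
  apply: (msn_le_add hq); rewrite ?rabs_ge0 ?rieszZ_ge0//.
  rewrite -{1}(subrK x (phi x *: u)) addrC riesz_leD2l.
  by rewrite -opprB leN_rabs.
Qed.

End Homomorphism.

End ConeSeminorms.

(** * Truncation characters *)
Section LatticeFunctionals.
Context {R : realType} {E : rieszType R}.
Implicit Types (a : R) (x y : E).

Record lattice_functional (phi : E -> R) : Prop := {
  lfun_linear : forall a x y, phi (a *: x + y) = a * phi x + phi y ;
  lfun_join : forall x y, phi (rjoin x y) = Num.max (phi x) (phi y)
}.

Variable phi : E -> R.
Hypothesis hphi : lattice_functional phi.

Lemma lfunD x y : phi (x + y) = phi x + phi y.
Proof. by rewrite -{1}[x]scale1r lfun_linear// mul1r. Qed.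

Lemma lfun0 : phi 0 = 0.
Proof. by apply: (addrI (phi 0)); rewrite -lfunD !addr0. Qed.

Lemma lfunZ a x : phi (a *: x) = a * phi x.
Proof. by rewrite -[a *: x]addr0 lfun_linear// lfun0 addr0. Qed.

Lemma lfunN x : phi (- x) = - phi x.
Proof. by rewrite -scaleN1r lfunZ mulN1r. Qed.

Lemma lfunB x y : phi (x - y) = phi x - phi y.
Proof. by rewrite lfunD lfunN. Qed.

Lemma lfun_meet x y : phi (rmeet x y) = Num.min (phi x) (phi y).
Proof. by rewrite rmeet_rjoinE lfunB lfunD lfun_join// -minr_to_max. Qed.

Lemma lfun_mono x y : x <= y -> phi x <= phi y.
Proof.
move=> xy; have <- : rjoin y x = y by exact: rjoin_l.
by rewrite lfun_join// le_max lexx orbT.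
Qed.

Lemma lfun_ge0 x : 0 <= x -> 0 <= phi x.
Proof. by rewrite -lfun0; exact: lfun_mono. Qed.

Lemma lfun_abs x : phi (rabs x) = `|phi x|.
Proof. by rewrite lfun_join// lfunN maxrN. Qed.

End LatticeFunctionals.

Section Characters.
Context {R : realType} {E : rieszType R} (tr : E -> E).
Implicit Types (a r : R) (x y : E) (s t phi : E -> R).

(** These are the functionals that become point evaluations; the condition on
    [tr] says that the truncation becomes the infimum with the constant
    function 1. *)
Record truncation_character phi : Prop := {
  character_lfun : lattice_functional phi ;
  character_trunc : forall x, 0 <= x -> phi (tr x) = Num.min (phi x) 1 ;
  character_neq0 : exists x, phi x != 0
}.

Lemma character_fixed_le1 phi x : truncation_character phi ->
  trunc_fixed tr x -> `|phi x| <= 1.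
Proof.
move=> hphi fx; rewrite -(lfun_abs (character_lfun hphi)) -fx.
by rewrite (character_trunc hphi (rabs_ge0 x)) ge_min lexx orbT.
Qed.

Lemma character_eq1 phi : truncation_character phi -> exists x, phi x = 1.
Proof.
move=> hphi; have [x x0] := character_neq0 hphi; exists ((phi x)^-1 *: x).
by rewrite (lfunZ (character_lfun hphi)) mulVf.
Qed.

(** Each character sends the truncation of a large positive element to 1, which
    fixes its scale. *)
Lemma character_proportional_eq s t c :
  truncation_character s -> truncation_character t ->
  (forall x, s x = c * t x) -> s = t.
Proof.
move=> hs ht sct; have ls := character_lfun hs; have lt := character_lfun ht.
suff c1 : c = 1 by apply/funext => x; rewrite sct c1 mul1r.
have [x tx] := character_eq1 ht.
have tax : t (rabs x) = 1 by rewrite (lfun_abs lt) tx normr1.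
have c0 : 0 < c.
  rewrite lt0r; apply/andP; split.
    have [z] := character_neq0 hs.
    by rewrite sct mulf_eq0 negb_or => /andP[].
  by have := lfun_ge0 ls (rabs_ge0 x); rewrite sct tax mulr1.
have k0 : 0 <= 1 + c^-1 by rewrite addr_ge0 ?invr_ge0 ?ltW.
have y0 : 0 <= (1 + c^-1) *: rabs x by rewrite rieszZ_ge0 ?rabs_ge0.
have := character_trunc hs y0; rewrite sct (character_trunc ht y0) sct.
rewrite (lfunZ lt) tax mulr1 !min_r ?mulr1//.
  by rewrite mulrDr mulr1 mulfV ?gt_eqF// lerDr ltW.
by rewrite lerDl invr_ge0 ltW.
Qed.

(** If every zero of [t] were a zero of [s], then [s] would be a multiple of
    [t]. *)
Lemma character_separation s t :
  truncation_character s -> truncation_character t -> s <> t ->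
  exists x, s x = 1 /\ t x = 0.
Proof.
move=> hs ht st; have ls := character_lfun hs; have lt := character_lfun ht.
suff [x [sx tx]] : exists x, s x != 0 /\ t x = 0.
  exists ((s x)^-1 *: x); split; first by rewrite (lfunZ ls) mulVf.
  by rewrite (lfunZ lt) tx mulr0.
apply: contrapT => nox; apply: st; have [e te] := character_eq1 ht.
apply: (character_proportional_eq hs ht (c := s e)) => x.
apply: contrapT => sx; apply: nox; exists (x - t x *: e); split.
  by rewrite (lfunB ls) (lfunZ ls) subr_eq0 mulrC; apply/eqP.
by rewrite (lfunB lt) (lfunZ lt) te mulr1 subrr.
Qed.

Lemma character_interpolation s t a b :
  truncation_character s -> truncation_character t -> (s = t -> a = b) ->
  exists x, s x = a /\ t x = b.
Proof.
move=> hs ht; have ls := character_lfun hs; have lt := character_lfun ht.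
have [<- /(_ erefl) <-|st _] := pselect (s = t).
  have [x sx] := character_eq1 hs; exists (a *: x).
  by rewrite (lfunZ ls) sx mulr1.
have [x [sx tx]] := character_separation hs ht st.
have [y [ty sy]] := character_separation ht hs (nesym st).
exists (a *: x + b *: y).
by rewrite !lfunD// !lfunZ// sx tx sy ty !mulr0 !mulr1 addr0 add0r.
Qed.

End Characters.

Section CharacterExistence.
Context {R : realType} {E : rieszType R} (N : E -> R) (tr : E -> E).
Hypothesis hE : truncated_normed_riesz N tr.
Hypothesis hfix : forall x : E, 0 <= x ->
  exists2 mu : R, 0 < mu & trunc_fixed tr (mu *: x).

Let htr := tnr_truncation hE.

Lemma trunc_norm_cone_Mseminorm : cone_Mseminorm (trunc_norm tr).
Proof.
have hg := trunc_norm_lattice_norm hE hfix; split.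
- move=> x y x0 xy; apply: (lattice_norm_le hg) => //.
  exact: le_trans xy (le_rabs y).
- by move=> x y _ _; exact: (lattice_normD hg).
- by move=> a x a0 _; rewrite (lattice_normZ hg) ger0_norm.
- exact: trunc_norm_join hE hfix.
Qed.

(** Dividing by the supremum over the fixed elements turns a lattice
    homomorphism into a character: [tr x] dominates [x /\ p] for every fixed
    [p], so the value at [tr x] is at least the minimum of the value at [x] and
    that supremum. *)
Lemma normalize_character (phi : E -> R) (w : E) (M : R) :
  lattice_functional phi -> 0 <= w -> phi w = 1 ->
  (forall x, 0 <= x -> tr x = x -> phi x <= M) ->
  exists2 c, 0 < c & truncation_character tr (fun x => phi x / c).
Proof.
move=> hphi w0 pw bound.
pose S := [set phi x | x in [set x | 0 <= x /\ tr x = x]].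
have SM : has_ubound S by exists M => _ [x [x0 tx] <-]; exact: bound.
have Strunc x : 0 <= x -> phi (tr x) <= sup S.
  move=> x0; apply: ub_le_sup => //; exists (tr x) => //=.
  by rewrite (truncation_ge0 htr x0) (trunc_idem htr x0).
have [mu mu0 fw] := hfix w0.
have c0 : 0 < sup S.
  have muw : 0 <= mu *: w by rewrite rieszZ_ge0// ltW.
  apply: (@lt_le_trans _ _ mu) => //.
  rewrite -[leLHS]mulr1 -pw -(lfunZ hphi) -(rabs_id muw) -fw.
  by apply: Strunc; exact: rabs_ge0.
have ci : 0 <= (sup S)^-1 by rewrite invr_ge0 ltW.
exists (sup S) => //; split.
- split=> [a x y|x y]; first by rewrite lfun_linear// mulrDl mulrA.
  by rewrite lfun_join// maxr_pMl.
- move=> x x0; rewrite -[X in Num.min _ X](mulfV (lt0r_neq0 c0)) -minr_pMl//.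
  congr (_ / _); apply: le_anti; apply/andP; split.
    by rewrite le_min Strunc// andbT (lfun_mono hphi)// (truncation_le htr).
  rewrite leNgt lt_min; apply/negP => /andP[xx xS].
  have Sne : S !=set0 by exists (phi (tr x)), (tr x) => //=;
    rewrite (truncation_ge0 htr x0) (trunc_idem htr x0).
  have [_ [p [p0 tp] <-]] := sup_gt Sne xS.
  apply/negP; rewrite -leNgt.
  have := lfun_mono hphi (truncation_meet htr x0 p0).
  rewrite (lfun_meet hphi) tp ge_min => /orP[h|//].
  by move: (lt_le_trans xx h); rewrite ltxx.
- by exists w; rewrite pw mul1r invr_neq0// gt_eqF.
Qed.

(** Apply the minimal-seminorm construction to the gauge and to [w]. *)
Lemma exists_character (w : E) : 0 <= w -> w != 0 ->
  exists2 phi, truncation_character tr phi & 0 < phi w.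
Proof.
move=> w0 wn0; have hg := trunc_norm_lattice_norm hE hfix.
have gw : 0 < trunc_norm tr w.
  rewrite lt0r (trunc_norm_ge0 hE hfix) andbT; apply/eqP.
  by move=> /(lattice_norm_eq0 hg)/eqP; apply/negP.
have [q [hq qg gq qmin]] := exists_minimal_msn trunc_norm_cone_Mseminorm w0.
have qw : 0 < q w := lt_le_trans gw gq.
have disj := minimal_msn_disjoint hq w0 qmin.
have [phi [lin join pw pq]] := exists_lattice_hom hq w0 qw disj.
have hphi : lattice_functional phi by [].
have [x x0 tx|c c0 hc] := normalize_character (M := (q w)^-1) hphi w0 pw.
  rewrite -[leRHS]mul1r ler_pdivlMr//; apply: le_trans (pq x x0) _.
  apply: le_trans (qg x x0) _; apply/(trunc_norm_leP hE hfix) => //.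
  by rewrite invr1 scale1r /trunc_fixed/= rabs_id.
by exists (fun x => phi x / c) => //; rewrite pw mul1r invr_gt0.
Qed.

End CharacterExistence.

(** * Approximation in spaces of functions vanishing at infinity *)
Section C0Approximation.
Context {R : realType} {X : topologicalType}.
Implicit Types (f g h : X -> R) (e : R) (s t : X).

Lemma continuous_abs f : continuous f -> continuous (fun t => `|f t|).
Proof.
by move=> cf t; apply: continuous_comp; [exact: cf | exact: norm_continuous].
Qed.

Lemma closed_ge_abs f e : continuous f -> closed [set t | e <= `|f t|].
Proof.
by move=> /continuous_abs/continuous_closedP/(_ _ (@closed_ge R e)).
Qed.

Lemma nbhs_ge_abs f e t : continuous f -> e < `|f t| ->
  nbhs t [set s | e <= `|f s|].
Proof.
move=> /continuous_abs cf et; apply: (cf t [set r | e <= r]).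
by apply: filterS (lt_nbhsr et) => r; exact: ltW.
Qed.

Lemma C0B f g : C0 f -> C0 g -> C0 (fun t => f t - g t).
Proof.
move=> [cf kf] [cg kg]; have cfg : continuous (fun t => f t - g t).
  by move=> t; apply: cvgB; [exact: cf | exact: cg].
split=> // e e0; have e2 : 0 < e / 2 by rewrite divr_gt0.
apply: (subclosed_compact (closed_ge_abs cfg) (compactU (kf _ e2) (kg _ e2))).
move=> t /= et; have [|ft] := leP (e / 2) `|f t|; first by left.
right; rewrite leNgt; apply/negP => gt.
have := le_lt_trans (le_trans et (ler_normB _ _)) (ltrD ft gt).
by rewrite -splitr ltxx.
Qed.

(** A Dini argument: if no [h] worked, the closed sets [{t | e <= h t}] would
    form a filter base, eventually inside a compact set because the functions
    vanish at infinity, and a cluster point would contradict the pointwise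
    hypothesis. *)
Lemma C0_directed_lt (H : set (X -> R)) e : 0 < e ->
  H !=set0 -> H `<=` @C0 R X -> (forall g h, H g -> H h -> H (g \min h)) ->
  (forall t, exists2 h, H h & h t < e) -> exists2 h, H h & forall t, h t < e.
Proof.
move=> e0 [h0 Hh0] HC0 Hmin Hpt; apply: contrapT => noh.
have ne h : H h -> [set t | e <= h t] !=set0.
  move=> Hh; apply: contrapT => empty; apply: noh; exists h => // t.
  by rewrite ltNge; apply/negP => et; apply: empty; exists t.
pose F := filter_from H (fun h => [set t | e <= h t]).
have FF : ProperFilter F.
  apply: filter_from_proper => //; apply: filter_from_filter.
    by exists h0.
  move=> g h Hg Hh; exists (g \min h); first exact: Hmin.
  by move=> t /=; rewrite le_min => /andP[].
have Fh0 : F [set t | e <= `|h0 t|].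
  by exists h0 => // t /= /le_trans; apply; exact: ler_norm.
have [p [_ clp]] := (HC0 _ Hh0).2 e e0 F FF Fh0.
have [h Hh hp] := Hpt p.
have Fh : F [set t | e <= h t] by exists h.
have nbh : nbhs p [set t | h t < e].
  by apply: ((HC0 _ Hh).1 p [set r | r < e]); exact: lt_nbhsl.
by have [t [/= h1 h2]] := clp _ _ Fh nbh; move: h2; rewrite ltNge h1.
Qed.

(** Apply the previous lemma twice: first to the functions [f - g] with [g]
    equal to [f] at a given point, then to [g - f] for the [g] so obtained. All
    these differences vanish at infinity, as the previous lemma requires. *)
Lemma lattice_Stone_Weierstrass (L : set (X -> R)) f e :
  L !=set0 -> L `<=` @C0 R X ->
  (forall g h, L g -> L h -> L (g \max h)) ->
  (forall g h, L g -> L h -> L (g \min h)) ->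
  (forall s t, exists2 g, L g & g s = f s /\ g t = f t) ->
  C0 f -> 0 < e -> exists2 g, L g & forall t, `|f t - g t| < e.
Proof.
move=> [g0 Lg0] LC0 Lmax Lmin Lint Cf e0.
have above s : exists2 g, L g & g s = f s /\ forall t, f t - g t < e.
  have [||||_ [g [Lg gs] <-] hg] := @C0_directed_lt
    [set (fun t => f t - g t) | g in [set g | L g /\ g s = f s]] e e0.
  - by have [g Lg [gs _]] := Lint s s; exists (fun t => f t - g t), g.
  - by move=> _ [g [Lg _] <-]; apply: C0B => //; exact: LC0.
  - move=> _ _ [g [Lg gs] <-] [h [Lh hs] <-]; exists (g \max h).
      by split; [exact: Lmax | rewrite /= gs hs maxxx].
    by apply/funext => t; rewrite /= oppr_max addr_minr.
  - move=> t; have [g Lg [gs gt]] := Lint s t.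
    by exists (fun t => f t - g t); [exists g | rewrite gt subrr].
  by exists g.
have [s0|noX] := pselect (exists s : X, True); last first.
  by exists g0 => // t; case: noX; exists t.
have [||||_ [g [Lg fg] <-] hg] := @C0_directed_lt
  [set (fun t => g t - f t) | g in
    [set g | L g /\ forall t, f t - g t < e]] e e0.
- have [s _] := s0.
  by have [g Lg [_ fg]] := above s; exists (fun t => g t - f t), g.
- by move=> _ [g [Lg _] <-]; apply: C0B => //; exact: LC0.
- move=> _ _ [g [Lg fg] <-] [h [Lh fh] <-]; exists (g \min h).
    split; first exact: Lmin.
    by move=> t; rewrite /= oppr_min addr_maxr gt_max fg fh.
  by apply/funext => t; rewrite /= addr_minl.
- move=> s; have [g Lg [gs fg]] := above s.
  by exists (fun t => g t - f t); [exists g | rewrite gs subrr].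
by exists g => // t; rewrite ltr_norml fg ltrNl opprB hg.
Qed.

End C0Approximation.

(** * The representation on the space of characters *)
Section CharacterSpace.
Context {R : realType} {E : rieszType R} (N : E -> R) (tr : E -> E).
Hypothesis hE : truncated_normed_riesz N tr.
Hypothesis hfix : forall x : E, 0 <= x ->
  exists2 mu : R, 0 < mu & trunc_fixed tr (mu *: x).

Definition character_set : set {ptws E -> R} :=
  [set phi | truncation_character tr phi].

(** The topology is the one induced by the product [{ptws E -> R}]: a filter
    converges when all its evaluations do. *)
Definition character_space : topologicalType := character_set.

Definition evaluation (x : E) (t : character_space) : R := set_val t x.

Lemma character_spaceP (t : character_space) :
  truncation_character tr (evaluation^~ t).
Proof. exact: set_valP. Qed.

Lemma character_space_inj (s t : character_space) :
  evaluation^~ s = evaluation^~ t -> s = t.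
Proof. by move=> st; exact: val_inj. Qed.

Lemma evaluation_continuous x : continuous (evaluation x).
Proof.
move=> t; apply: (continuous_comp (g := fun phi : {ptws E -> R} => phi x)).
  exact: initial_continuous.
exact: proj_continuous.
Qed.

Lemma cvg_character_space (F : set_system character_space)
    (t : character_space) : Filter F ->
  (forall x, evaluation x @ F --> evaluation x t) -> F --> t.
Proof.
move=> FF cvF.
have cvval : set_val @ F --> (set_val t : {ptws E -> R}).
  apply/cvg_sup => x A [_ [[B Bop <-] Bt] sBA].
  apply: filterS sBA _; apply: (cvF x); exact: open_nbhs_nbhs.
move=> A [_ [[B Bop <-] Bt] sBA].
by apply: filterS sBA _; apply: cvval; exact: open_nbhs_nbhs.
Qed.

Lemma character_space_hausdorff : hausdorff_space character_space.
Proof.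
move=> s t clst; apply: character_space_inj; apply/funext => x.
apply: Rhausdorff => A B sA tB.
have [r [rA rB]] := clst _ _
  (evaluation_continuous sA) (evaluation_continuous tB).
by exists (evaluation x r).
Qed.

(** If [y = x / l] is not fixed, then some character is positive on
    [|y| - tr |y|], and its value at [|y|] exceeds 1. *)
Lemma trunc_norm_le_characters x (l : R) : 0 < l ->
  trunc_norm tr x <= l <-> forall t, `|evaluation x t| <= l.
Proof.
move=> l0; have li : 0 < l^-1 by rewrite invr_gt0.
have htr := tnr_truncation hE; split.
  move=> /(trunc_norm_leP hE hfix _ l0) fx t.
  have := character_fixed_le1 (character_spaceP t) fx.
  rewrite (lfunZ (character_lfun (character_spaceP t))) normrM gtr0_norm//.
  by rewrite ler_pdivrMl// mulr1.
move=> hx; apply/(trunc_norm_leP hE hfix) => //.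
set y := l^-1 *: x; apply/eqP.
rewrite eq_sym -subr_eq0; apply/negPn/negP => wn0.
have y0 := rabs_ge0 y.
have w0 : 0 <= rabs y - tr (rabs y).
  by rewrite riesz_subr_ge0 (truncation_le htr).
have [phi hphi] := exists_character hE hfix w0 wn0.
have lphi := character_lfun hphi.
rewrite (lfunB lphi) (character_trunc hphi y0) subr_gt0 gt_min ltxx/=.
rewrite (lfun_abs lphi) /y (lfunZ lphi) normrM (gtr0_norm li).
rewrite ltr_pdivlMl// mulr1 ltNge => /negP; apply.
by have := hx (exist _ phi (mem_set hphi)); rewrite /evaluation set_valE.
Qed.

(** A cluster point of an ultrafilter is a limit. *)
Lemma ultra_bounded_cvg (T : Type) (F : set_system T) (f : T -> R) (M : R) :
  UltraFilter F -> (forall t, `|f t| <= M) -> exists l : R, f @ F --> l.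
Proof.
move=> UF fM.
have [|l [_ cl]] := @segment_compact R (- M) M (f @ F) _.
  apply: (@filterS _ F _ setT) => [t _ /=|]; last exact: filterT.
  by rewrite in_itv/= -ler_norml.
exists l => B lB; have [//|FnB] := in_ultra_setVsetC (f @^-1` B) UF.
by have [r [nBr /nBr]] := cl (~` B) B FnB lB.
Qed.

(** Along an ultrafilter all evaluations converge, since each is bounded by the
    gauge. The limit functional inherits the identities that define characters,
    and [e <= `|l x|] keeps it from being zero. *)
Lemma evaluation_compact x (e : R) : 0 < e ->
  compact [set t | e <= `|evaluation x t|].
Proof.
move=> e0; rewrite compact_ultra => F UF Fx.
have FF : ProperFilter F by exact: ultra_proper.
have /choice[l hl] y : exists r : R, evaluation y @ F --> r.
  have k0 : 0 < trunc_norm tr y + 1.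
    by rewrite ltr_wpDl ?(trunc_norm_ge0 hE hfix).
  apply: (ultra_bounded_cvg UF).
  by apply/(trunc_norm_le_characters _ k0); rewrite lerDl.
have limE y r : evaluation y @ F --> r -> l y = r.
  by move=> hr; exact: (cvg_unique (@Rhausdorff R) (hl y) hr).
have hlin a y z : l (a *: y + z) = a * l y + l z.
  apply: limE.
  rewrite (_ : evaluation _ = fun t => a * evaluation y t + evaluation z t).
    by apply: cvgD (hl z); apply: cvgMr (hl y).
  apply/funext => t.
  exact: (lfun_linear (character_lfun (character_spaceP t))).
have hmax y z : (fun t => Num.max (evaluation y t) (evaluation z t)) @ F -->
    Num.max (l y) (l z).
  under eq_fun do rewrite maxr_absE; rewrite maxr_absE.
  by apply: cvgMl; apply: cvgD (cvg_norm (cvgB (hl y) (hl z))); exact: cvgD.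
have hl_char : truncation_character tr l.
  split; first split => // y z.
  - apply: limE; rewrite (_ : evaluation _ =
      fun t => Num.max (evaluation y t) (evaluation z t))//.
    apply/funext => t.
    exact: (lfun_join (character_lfun (character_spaceP t))).
  - move=> y y0; apply: limE; rewrite (_ : evaluation _ =
      fun t => Num.min (evaluation y t) 1); last first.
      apply/funext => t; exact: (character_trunc (character_spaceP t)).
    under eq_fun do rewrite minr_absE; rewrite minr_absE.
    apply: cvgMl; apply: cvgB; first exact: cvgD (hl y) (cvg_cst _).
    exact: cvg_norm (cvgB (hl y) (cvg_cst _)).
  - exists x; rewrite -normr_gt0; apply: lt_le_trans e0 _.
    exact: closed_cvg (@closed_ge R e) Fx _ (cvg_norm (hl x)).
pose t : character_space := exist _ l (mem_set hl_char).
have tE y : evaluation y t = l y by rewrite /evaluation set_valE.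
exists t; split; last by apply: cvg_character_space => y; rewrite tE; exact: hl.
rewrite /= tE; exact: closed_cvg (@closed_ge R e) Fx _ (cvg_norm (hl x)).
Qed.

Lemma evaluation_C0 x : C0 (evaluation x).
Proof.
by split; [exact: evaluation_continuous | exact: evaluation_compact].
Qed.

Lemma character_space_locally_compact : locally_compact [set: character_space].
Proof.
move=> t _; have [x xt] := character_neq0 (character_spaceP t).
have e0 : 0 < `|evaluation x t| / 2 by rewrite divr_gt0 ?normr_gt0.
exists [set s | `|evaluation x t| / 2 <= `|evaluation x s|]; last first.
  split; first exact: evaluation_compact.
  exact: closed_ge_abs (@evaluation_continuous x).
rewrite withinET.
apply: nbhs_ge_abs; first exact: evaluation_continuous.
by rewrite ltr_pdivrMr// ltr_pMr ?normr_gt0// ltr1n.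
Qed.

Lemma character_space_neq0 : [set: character_space] !=set0.
Proof.
have [x xn0] := truncation_space_neq0 (tnr_truncation hE).
have axn0 : rabs x != 0.
  by apply: contra_neq xn0; exact: rabs_eq0.
have [phi hphi _] := exists_character hE hfix (rabs_ge0 x) axn0.
by exists (exist _ phi (mem_set hphi)).
Qed.

Lemma sup_norm_evaluation x : sup_norm (evaluation x) = trunc_norm tr x.
Proof.
have [t0 _] := character_space_neq0.
have ne : range (fun t => `|evaluation x t|) !=set0.
  by exists `|evaluation x t0|, t0.
have bound t : `|evaluation x t| <= trunc_norm tr x.
  apply/ler_addgt0Pr => e e0.
  have k0 : 0 < trunc_norm tr x + e.
    by rewrite ltr_wpDl ?(trunc_norm_ge0 hE hfix).
  by move: t; apply/(trunc_norm_le_characters _ k0); rewrite lerDl ltW.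
apply: le_anti; apply/andP; split.
  by apply: ge_sup => // _ [t _ <-].
have le_sup t : `|evaluation x t| <= sup_norm (evaluation x).
  by apply: ub_le_sup; [exists (trunc_norm tr x) => _ [s _ <-] | exists t].
apply/ler_addgt0Pr => e e0.
have k0 : 0 < sup_norm (evaluation x) + e.
  by rewrite ltr_wpDl// (le_trans _ (le_sup t0)).
apply/(trunc_norm_le_characters _ k0) => t.
by apply: le_trans (le_sup t) _; rewrite lerDl ltW.
Qed.

Lemma evaluation_inj x y : evaluation x = evaluation y -> x = y.
Proof.
move=> xy; apply/eqP; rewrite -subr_eq0; apply/eqP.
have hg := trunc_norm_lattice_norm hE hfix.
apply: (lattice_norm_eq0 hg); apply: le_anti.
rewrite (trunc_norm_ge0 hE hfix) andbT; apply/ler_addgt0Pr => e e0.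
rewrite add0r; apply/(trunc_norm_le_characters _ e0) => t.
rewrite (lfunB (character_lfun (character_spaceP t))).
by rewrite xy subrr normr0 ltW.
Qed.

(** Evaluations form a lattice of functions that interpolates any values at two
    characters. *)
Lemma evaluation_dense f (e : R) : C0 f -> 0 < e ->
  exists x, forall t, `|f t - evaluation x t| < e.
Proof.
move=> Cf e0.
have [||||| _ [x _ <-] hx] := @lattice_Stone_Weierstrass R character_space
  (range evaluation) f e _ _ _ _ _ Cf e0.
- by exists (evaluation 0), 0.
- by move=> _ [x _ <-]; exact: evaluation_C0.
- move=> _ _ [x _ <-] [y _ <-]; exists (rjoin x y) => //; apply/funext => t.
  exact: (lfun_join (character_lfun (character_spaceP t))).
- move=> _ _ [x _ <-] [y _ <-]; exists (rmeet x y) => //; apply/funext => t.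
  exact: (lfun_meet (character_lfun (character_spaceP t))).
- move=> s t; have [|x xst] := character_interpolation (a := f s) (b := f t)
      (character_spaceP s) (character_spaceP t).
    by move=> /character_space_inj ->.
  by exists (evaluation x).
by exists x.
Qed.

Lemma norm_le_trunc_norm x (l : R) : 0 < l -> trunc_norm tr x <= l -> N x <= l.
Proof.
move=> l0 /(trunc_norm_leP hE hfix _ l0)/(trunc_fixed_norm_le1 hE).
rewrite (lattice_normZ (tnr_lattice_norm hE)) gtr0_norm ?invr_gt0//.
by rewrite ler_pdivrMl// mulr1.
Qed.

(** Approximants of [f] are Cauchy for the gauge, hence for the smaller norm
    [N], and so have a limit in [E]. Since the fixed elements are closed for
    [N], the Cauchy estimates in the gauge pass to that limit. *)
Lemma evaluation_surj f : norm_complete N -> C0 f ->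
  exists x, evaluation x = f.
Proof.
move=> Ncomp Cf; have hN := tnr_lattice_norm hE.
have hu0 (n : nat) : exists x, forall t, `|f t - evaluation x t| < n.+1%:R^-1.
  by apply: evaluation_dense; rewrite ?invr_gt0.
have [u hu] := choice hu0.
have near_inv (e : R) : 0 < e ->
    exists n, forall p, (n <= p)%N -> p.+1%:R^-1 <= e.
  move=> e0; have [n _ hn] := near_infty_natSinv_lt (PosNum e0).
  by exists n => p /hn/ltW.
have cauchy (e : R) : 0 < e -> exists n, forall p q, (n <= p)%N -> (n <= q)%N ->
    trunc_norm tr (u p - u q) <= e.
  move=> e0; have e2 : 0 < e / 2 by rewrite divr_gt0.
  have [n hn] := near_inv _ e2; exists n => p q np nq.
  apply/(trunc_norm_le_characters _ e0) => t.
  rewrite (lfunB (character_lfun (character_spaceP t))).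
  rewrite -[X in `|X|](subrKA (f t)) addrC.
  apply: le_trans (ler_normD _ _) _; rewrite [e]splitr; apply: lerD.
    exact: le_trans (ltW (hu q t)) (hn q nq).
  by rewrite distrC; exact: le_trans (ltW (hu p t)) (hn p np).
have [|x hx] := Ncomp u.
  move=> e e0; have e2 : 0 < e / 2 by rewrite divr_gt0.
  have [n hn] := cauchy _ e2; exists n => p q np nq.
  apply: le_lt_trans (norm_le_trunc_norm e2 (hn p q np nq)) _.
  by rewrite ltr_pdivrMr// ltr_pMr// ltr1n.
have limit (e : R) : 0 < e -> exists n, forall p, (n <= p)%N ->
    trunc_norm tr (u p - x) <= e.
  move=> e0; have [n hn] := cauchy _ e0; exists n => p np.
  apply/(trunc_norm_leP hE hfix) => //; apply: (trunc_fixed_closed hE) => d d0.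
  have [m hm] := hx _ (mulr_gt0 e0 d0); pose q := maxn n m.
  exists (e^-1 *: (u p - u q)).
    by apply/(trunc_norm_leP hE hfix) => //; apply: hn => //; exact: leq_maxl.
  rewrite -scalerBr opprB addrC addrA subrK (lattice_normZ hN).
  rewrite gtr0_norm ?invr_gt0// ltr_pdivrMl//.
  exact: hm (leq_maxr _ _).
exists x; apply/funext => t; apply/eqP; rewrite -subr_eq0 -normr_le0.
apply/ler_addgt0Pr => e e0; rewrite add0r.
have e2 : 0 < e / 2 by rewrite divr_gt0.
have [n hn] := limit _ e2; have [m hm] := near_inv _ e2; pose p := maxn n m.
have := hn p (leq_maxl _ _); move=> /(trunc_norm_le_characters _ e2)/(_ t).
rewrite (lfunB (character_lfun (character_spaceP t))) => hp.
rewrite distrC -[X in `|X|](subrKA (evaluation (u p) t)) [e]splitr.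
apply: le_trans (ler_normD _ _) (lerD _ hp).
exact: le_trans (ltW (hu p t)) (hm p (leq_maxr _ _)).
Qed.

End CharacterSpace.

Theorem corollary4p3 (R : realType) (E : rieszType R)
    (N : E -> R) (tr : E -> E) (hE : truncated_banach_lattice N tr)
    (hfix : forall x : E, 0 <= x ->
      exists2 mu : R, 0 < mu & trunc_fixed tr (mu *: x)) :
  lattice_norm (trunc_norm tr) /\
  exists X : topologicalType,
    [/\ hausdorff_space X, locally_compact [set: X] &
        exists phi : E -> (X -> R), lattice_isometry_C0 (trunc_norm tr) phi].
Proof.
have [hT Ncomp] := hE; split; first exact: trunc_norm_lattice_norm hT hfix.
exists (character_space tr); split.
- exact: character_space_hausdorff.
- exact: character_space_locally_compact hT hfix.
exists (@evaluation R E tr); split.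
- move=> a x y; apply/funext => t.
  exact: (lfun_linear (character_lfun (character_spaceP t))).
- move=> x y; apply/funext => t.
  exact: (lfun_join (character_lfun (character_spaceP t))).
- move=> x y; apply/funext => t.
  exact: (lfun_meet (character_lfun (character_spaceP t))).
- split.
  + by move=> x _; exact: (evaluation_C0 hT hfix).
  + by move=> x y _ _; exact: (evaluation_inj hT hfix).
  + by move=> f /(evaluation_surj hT hfix Ncomp)[x <-]; exists x.
- exact: (sup_norm_evaluation hT hfix).
Qed.
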